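(* Let $(a_m)_{m\ge 1}$ be an arbitrary sequence of complex numbers, let $t$ be a complex number with $t\neq 0$ and $t\neq 1$, and let $n$ be a positive integer. Then $$\sum_{\pi\in P(n)} t^{k(\pi)-1}\left(\frac{t-1}{t}\right)^{Q(\pi)-1}\sum_{j=1}^{s(\pi)} a_{l(\pi)-s(\pi)+j}=\sum_{d\mid n} t^{d}\left(\frac{a_1}{t}+\frac{a_2}{t^2}+\cdots+\frac{a_d}{t^d}\right),$$ where the sum on the right is over all positive divisors $d$ of $n$.
   Context: A partition of a positive integer $n$ is a sequence $\pi=(k_1,k_2,\dots)$ of non-negative integers, only finitely many nonzero, with $n=\sum_{j\ge1} j k_j$; the integer $k_j$ is the multiplicity of the part $j$, and the parts of $\pi$ are the $j$ with $k_j>0$. $P(n)$ denotes the set of all partitions of $n$. For $\pi\in P(n)$: $k(\pi)=\sum_j k_j$ is the total number of parts (counted with multiplicity), $Q(\pi)=\#\{j: k_j>0\}$ is the number of distinct parts, $s(\pi)$ is the smallest part, and $l(\pi)$ is the largest part. *)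

(* Defs.v *)
From mathcomp Require Import all_boot.

Set Implicit Arguments.
Unset Strict Implicit.
Unset Printing Implicit Defensive.

(* A partition of n is given by its multiplicities: [pi i] is the multiplicity
   k_(i+1) of the part i.+1, for i < n.  Since j * k_j <= n for every part j of
   a partition of n, restricting to parts at most n and multiplicities at most n
   loses nothing and makes the set of all partitions of n a finite set. *)
Definition multiplicities (n : nat) := {ffun 'I_n -> 'I_n.+1}.

Section Partitions.
Variable n : nat.
Implicit Type pi : multiplicities n.

Definition partitions : {set multiplicities n} :=
  [set pi : multiplicities n | \sum_(i < n) i.+1 * pi i == n].

Definition num_parts pi : nat := \sum_(i < n) pi i.

Definition num_distinct_parts pi : nat := #|[set i : 'I_n | 0 < pi i]|.

(* The initial value n is harmless: all parts are at most n, and for n > 0 a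
   partition of n has at least one part. *)
Definition smallest_part pi : nat := \big[minn/n]_(i < n | 0 < pi i) i.+1.

Definition largest_part pi : nat := \max_(i < n | 0 < pi i) i.+1.

End Partitions.

(* Main.v *)
(* Multiply by [t - 1]: the weight of a partition becomes a product over the
   parts j of a factor with generating function
     phi_j = 1 + \sum_(k > 0) t^(k-1) (t-1) x^(jk) = (1 - x^j) / (1 - t x^j).
   The coefficient of [a m] collects the partitions with l - s < m <= l.  Those
   with largest part l are counted by the product of the phi_j over the window
   l-m < j <= l minus the product over l-m < j < l.  Summed over l, this gives
   (t-1) L_m with
     L_m = \sum_(l >= m) (\prod_(l-m < j < l) phi_j) x^l / (1 - t x^l),
   and L_m - t L_(m+1) telescopes to x^m / (1 - x^m).  Hence
     L_m = \sum_(d >= m) t^(d-m) x^d / (1 - x^d).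
   Power series are replaced by polynomials modulo X^(n+1), that is, x is a
   nilpotent element of a commutative ring. *)
Require Import Defs.
From mathcomp Require Import all_boot all_order all_algebra.
From mathcomp Require Import reals.
From mathcomp Require Import complex.
From mathcomp Require Import qpoly.
From mathcomp Require Import ring zify.
Import GRing.Theory Num.Theory.
Local Open Scope ring_scope.

Definition mult_weight (A : nzRingType) (t : A) (k : nat) : A :=
  if k is k'.+1 then t ^+ k' * (t - 1) else 1.

(** The series [phi_j] at [y = x ^+ j], cut after exponent [n]; nothing is lost when
    [y ^+ n.+1 = 0]. *)
Definition part_gf (A : nzRingType) (n : nat) (t y : A) : A :=
  \sum_(k < n.+1) mult_weight A t k * y ^+ k.

Lemma rmorph_mult_weight (A B : nzRingType) (f : {rmorphism A -> B}) t k :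
  f (mult_weight A t k) = mult_weight B (f t) k.
Proof. by case: k => [|k]; rewrite ?rmorph1 //= rmorphM rmorphXn rmorphB rmorph1. Qed.

Lemma rmorph_part_gf (A B : nzRingType) (f : {rmorphism A -> B}) n t y :
  f (part_gf A n t y) = part_gf B n (f t) (f y).
Proof.
rewrite rmorph_sum; apply: eq_bigr => k _.
by rewrite rmorphM rmorphXn rmorph_mult_weight.
Qed.

(** * Telescoping identity for window products at a nilpotent element *)

Section NilpotentIdentity.
Variables (A : comNzRingType) (n : nat) (t x : A).
Hypothesis x_nil : x ^+ n.+1 = 0.

(** A truncated geometric series, playing the role of 1 / (1 - t x^j) for [j > 0]. *)
Let e j : A := \sum_(k < n.+1) (t * x ^+ j) ^+ k.
Let phi j : A := part_gf A n t (x ^+ j).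

Let pow_eq0 j : (n < j)%N -> x ^+ j = 0.
Proof. by move=> lt_nj; rewrite -(subnK lt_nj) exprD x_nil mulr0. Qed.

Let pow_nil j : (0 < j)%N -> (x ^+ j) ^+ n.+1 = 0.
Proof. by case: j => // j _; rewrite -exprM mulnC exprM x_nil expr0n. Qed.

Let e_inv j : (0 < j)%N -> (1 - t * x ^+ j) * e j = 1.
Proof.
move=> j_gt0; rewrite -[LHS]opprK -mulNr opprB -subrX1 exprMn pow_nil //.
by rewrite mulr0 sub0r opprK.
Qed.

Let phi_e j : (0 < j)%N -> phi j = (1 - x ^+ j) * e j.
Proof.
move=> j_gt0; have inv := e_inv j j_gt0.
have -> : phi j = 1 + (t - 1) * (x ^+ j * e j).
  rewrite /phi /part_gf big_ord_recl mulr1 /e big_ord_recr /= mulrDr.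
  rewrite exprMn mulrCA -exprS pow_nil // mulr0 addr0 !mulr_sumr; congr (_ + _).
  by apply: eq_bigr => k _; rewrite /= add0n exprMn exprS; ring.
by rewrite -[X in X + _]inv; ring.
Qed.

Let phi1 j : (n < j)%N -> phi j = 1.
Proof.
move=> lt_nj; rewrite phi_e ?(leq_ltn_trans _ lt_nj) // -[RHS](e_inv j).
  by rewrite pow_eq0 // mulr0.
exact: leq_ltn_trans lt_nj.
Qed.

(* Indices are shifted: [B r m] is the product over the parts r < j <= r + m and
   [L m] is the series L_(m+1) above, truncated and summed over r = l - m - 1. *)
Let B r m : A := \prod_(r <= i < r + m) phi i.+1.
Let L m : A := \sum_(0 <= r < n.+1) B r m * e (r + m.+1) * x ^+ (r + m.+1).
(** The potential whose increments in [r] give, up to the factor x^(m+1) / (1 - x^(m+1)), the terms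
    of [L m - t * L m.+1]. *)
Let U m r : A := (1 - x ^+ r) * B r m * e (r + m.+1).

Let B_recr r m : B r m.+1 = B r m * phi (r + m.+1).
Proof. by rewrite /B addnS big_nat_recr ?leq_addr. Qed.

(** The two windows differ by the factor [phi r.+1]; its denominator is cleared. *)
Let B_shift r m : (1 - x ^+ r.+1) * B r.+1 m = (1 - t * x ^+ r.+1) * B r m.+1.
Proof.
rewrite /B addnS addSn [in RHS]big_ltn ?ltnS ?leq_addr // phi_e // mulrA.
by rewrite mulrCA e_inv // mulr1.
Qed.

Let term_telescope m r :
  (1 - x ^+ m.+1) * (B r m * e (r + m.+1) * x ^+ (r + m.+1)
                      - t * (B r m.+1 * e (r + m.+2) * x ^+ (r + m.+2)))
  = x ^+ m.+1 * (U m r.+1 - U m r).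
Proof.
rewrite /U B_shift B_recr phi_e ?addnS // addSn -addnS.
have inv : (1 - t * x ^+ (r + m.+2)) * e (r + m.+2) = 1 by rewrite e_inv ?addnS.
apply/eqP; rewrite -subr_eq0; apply/eqP; set lhs := LHS.
(* The difference of the two sides contains the factor 1 - (1 - t x^j) e_j with j = r + m + 2, which
   is zero. *)
have -> : lhs = B r m * e (r + m.+1)
    * ((1 - x ^+ m.+1) * x ^+ (r + m.+1) + x ^+ m.+1 * (1 - x ^+ r))
    * (1 - (1 - t * x ^+ (r + m.+2)) * e (r + m.+2)).
  by rewrite /lhs -?addnS !exprD !exprS; ring.
by rewrite inv subrr mulr0.
Qed.

Let L_rec m : L m = t * L m.+1 + \sum_(1 <= k < n.+1) x ^+ (m.+1 * k).
Proof.
apply/eqP; rewrite addrC -subr_eq; apply/eqP.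
have tele : (1 - x ^+ m.+1) * (L m - t * L m.+1) = x ^+ m.+1.
  rewrite /L mulr_sumr -sumrB mulr_sumr (eq_bigr _ (fun r _ => term_telescope m r)).
  (* [U m 0] vanishes because 1 - x^0 = 0, and [U m n.+1] is 1 because all its factors have index
     above [n]. *)
  rewrite -mulr_sumr telescope_sumr // /U x_nil expr0 !subrr !mul0r subr0 subr0 mul1r.
  rewrite /B big_nat big1 => [|i /andP[/leqW ? _]]; last exact: phi1.
  have := e_inv (n.+1 + m.+1); rewrite pow_eq0; last by rewrite ltnS leq_addr.
  by rewrite mulr0 subr0 mul1r => ->; rewrite ?addnS // !mulr1.
have geo : (\sum_(k < n.+1) (x ^+ m.+1) ^+ k) * (1 - x ^+ m.+1) = 1.
  by rewrite mulrC -[LHS]opprK -mulNr opprB -subrX1 pow_nil // sub0r opprK.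
rewrite -[LHS]mul1r -geo -mulrA tele mulr_suml big_ord_recr /= -exprSr pow_nil //.
rewrite addr0 big_add1 big_mkord.
by apply: eq_bigr => k _; rewrite -exprSr -exprM.
Qed.

Let L_eq0 m : (n <= m)%N -> L m = 0.
Proof.
move=> le_nm; rewrite /L big1 // => r _; rewrite pow_eq0 ?mulr0 //.
by rewrite addnS ltnS (leq_trans le_nm) // leq_addl.
Qed.

Let L_eq m : (m <= n)%N ->
  L m = \sum_(m.+1 <= d < n.+1) t ^+ (d - m.+1)
          * \sum_(1 <= k < n.+1) x ^+ (d * k).
Proof.
move=> le_mn; rewrite -(subKn le_mn).
(* Downward induction from [L n = 0]: each use of [L_rec] adds the term [d = m.+1] and multiplies
   the others by [t]. *)
elim: (n - m)%N (leq_subr m n) => [|i IH] lt_in.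
  by rewrite subn0 L_eq0 // big_geq.
rewrite L_rec [in RHS]big_ltn; last by rewrite ltnS; lia.
rewrite subnn mul1r addrC; congr (_ + _).
have -> : (n - i.+1).+1 = (n - i)%N by lia.
rewrite IH ?(ltnW lt_in) // mulr_sumr; apply: eq_big_nat => d /andP[lt_d _].
by rewrite mulrA -exprS; congr (t ^+ _ * _); lia.
Qed.

(** With l = r + m + 1, each difference is [B r m] times phi_l - 1 = (t - 1) x^l / (1 - t x^l), so
    the sum is [(t - 1) * L m]; terms of [L m] with l > n vanish. *)
Lemma window_identity m : (m < n)%N ->
  \sum_(0 <= r < n - m)
     (\prod_(r <= i < r + m.+1) part_gf A n t (x ^+ i.+1)
      - \prod_(r <= i < r + m) part_gf A n t (x ^+ i.+1))
  = (t - 1) * \sum_(m.+1 <= d < n.+1) t ^+ (d - m.+1)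
                * \sum_(1 <= k < n.+1) x ^+ (d * k).
Proof.
move=> lt_mn; rewrite -L_eq 1?ltnW // /L.
rewrite [in RHS](@big_cat_nat _ _ _ (n - m)) ?(leqW (leq_subr _ _)) //=.
rewrite [X in _ * (_ + X)]big_nat [X in _ * (_ + X)]big1 => [|r /andP[le_r _]]; last first.
  by rewrite pow_eq0 ?mulr0 //; lia.
rewrite addr0 mulr_sumr; apply: eq_bigr => r _.
rewrite -/(B r m.+1) -/(B r m) B_recr phi_e ?addnS // -addnS.
have inv : (1 - t * x ^+ (r + m.+1)) * e (r + m.+1) = 1 by rewrite e_inv ?addnS.
by rewrite -[X in _ - X]mulr1 -[X in _ - _ * X]inv; ring.
Qed.

End NilpotentIdentity.

(** * Window products as generating functions of partitions *)

Lemma in_qpolyXn_coef (A : comNzRingType) n (p q : {poly A}) :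
  in_qpoly 'X^(n.+1) p = in_qpoly 'X^(n.+1) q -> p`_n = q`_n.
Proof.
move/(congr1 (fun u : {poly %/ 'X^(n.+1)} => (u : {poly A})`_n)) => /=.
by rewrite mk_monic_Xn -!Pdiv.RingMonic.take_poly_rmodp !coef_take_poly ltnSn.
Qed.

(* All parts i.+1 of [pi] satisfy r < i.+1 <= p. *)
Definition parts_in n (pi : multiplicities n) (r p : nat) : bool :=
  [forall i : 'I_n, (0 < pi i)%N ==> (r <= i < p)%N].

Lemma coef_window_prod (A : comNzRingType) (t : A) n r p : (p <= n)%N ->
  (\prod_(r <= i < p) part_gf {poly A} n t%:P ('X ^+ i.+1))`_n
  = \sum_(pi in partitions n)
       (\prod_i mult_weight A t (pi i)) * (parts_in n pi r p)%:R.
Proof.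
move=> le_pn.
(* Outside the window only multiplicity 0 is allowed. The product then runs over all parts, and
   distributing it gives a sum over all multiplicity functions. *)
pose F (i : 'I_n) (k : 'I_n.+1) : A :=
  if (r <= i < p)%N then mult_weight A t k else (nat_of_ord k == 0%N)%:R.
have -> : \prod_(r <= i < p) part_gf {poly A} n t%:P ('X ^+ i.+1)
  = \prod_(i < n) \sum_(k < n.+1) F i k *: 'X^(i.+1 * k).
  rewrite (big_nat_widenl _ 0) // (big_nat_widen _ _ n) // big_mkord big_mkcond.
  apply: eq_bigr => i _; rewrite /F; case: ifP => _.
    by apply: eq_bigr => k _; rewrite -mul_polyC -exprM (rmorph_mult_weight _ _ polyC).
  rewrite big_ord_recl /= scale1r muln0 big1 ?addr0 // => k _.
  by rewrite scale0r.
rewrite bigA_distr_bigA coef_sum [RHS]big_mkcond /=; apply: eq_bigr => pi _.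
under eq_bigr do rewrite -mul_polyC.
rewrite big_split /= -rmorph_prod -expr_sum coefCM coefXn inE eq_sym.
case: ifP => _; rewrite ?mulr0 // mulr1.
case: (boolP (parts_in n pi r p)) => [/forallP in_rp|not_in].
  rewrite mulr1; apply: eq_bigr => i _; rewrite /F; move/implyP: (in_rp i).
  by case: ifP => // _; case: (nat_of_ord (pi i)) => // k /(_ isT).
move: not_in; rewrite negb_forall => /existsP; case=> i.
rewrite negb_imply mulr0 => /andP[pi_gt0 /negbTE not_in].
by rewrite (bigD1 i) //= {1}/F not_in (negbTE (lt0n_neq0 pi_gt0)) mul0r.
Qed.

(** * Windows in terms of the smallest and largest parts *)

Section SmallestLargest.
Variables (n : nat) (pi : multiplicities n).
Hypotheses (n_gt0 : (0 < n)%N) (pi_part : pi \in partitions n).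

Lemma part_exists : exists i, (0 < pi i)%N.
Proof.
apply/existsP; apply: contraTT pi_part; rewrite negb_exists inE => /forallP pi0.
rewrite big1 1?ltn_eqF // => i _.
by move: (pi0 i); rewrite -leqNgt leqn0 => /eqP->; rewrite muln0.
Qed.

Lemma smallest_part_leq_part (i : 'I_n) : (0 < pi i)%N -> (smallest_part pi <= i.+1)%N.
Proof. exact: (Order.TotalTheory.bigmin_le_cond n (fun i : 'I_n => i.+1)). Qed.

(** The bound on [r] handles the initial value [n] of the minimum. *)
Lemma ltn_smallest_part r : (r < n)%N ->
  (r < smallest_part pi)%N = [forall i : 'I_n, (0 < pi i)%N ==> (r <= i)%N].
Proof.
move=> lt_rn; apply/idP/forallP => [lt_rs i|le_r].
  by apply/implyP => /smallest_part_leq_part; exact: leq_trans lt_rs.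
rewrite /smallest_part; elim/big_ind: _ => // [x y|i /(implyP (le_r i))//].
by rewrite leq_min => -> ->.
Qed.

Lemma leq_largest_part p :
  (largest_part pi <= p)%N = [forall i : 'I_n, (0 < pi i)%N ==> (i < p)%N].
Proof.
apply/bigmax_leqP/forallP => [le_p i|le_p i /(implyP (le_p i)) //].
exact/implyP/le_p.
Qed.

Lemma parts_inE r p : (r < n)%N ->
  parts_in n pi r p = (r < smallest_part pi)%N && (largest_part pi <= p)%N.
Proof.
move=> lt_rn; rewrite ltn_smallest_part // leq_largest_part.
apply/forallP/andP => [in_rp|[/forallP le_r /forallP le_p] i].
  by split; apply/forallP => i; apply/implyP => /(implyP (in_rp i)) /andP[].
by apply/implyP => pi_gt0; rewrite (implyP (le_r i)) ?(implyP (le_p i)).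
Qed.

Lemma largest_part_leq : (largest_part pi <= n)%N.
Proof. by apply/bigmax_leqP => i _; exact: ltn_ord. Qed.

Lemma smallest_part_leq : (smallest_part pi <= largest_part pi)%N.
Proof.
have [i pi_gt0] := part_exists.
exact: leq_trans (smallest_part_leq_part i pi_gt0) (leq_bigmax_cond _ pi_gt0).
Qed.

Lemma smallest_part_gt0 : (0 < smallest_part pi)%N.
Proof. by rewrite ltn_smallest_part //; apply/forallP => i; rewrite implybT. Qed.

(** The difference at [r] is 1 exactly when the largest part is r + m + 1 and [r] is below the
    smallest part; at most one [r] qualifies. *)
Lemma sum_parts_in_windows (A : nzRingType) m : (m < n)%N ->
  \sum_(0 <= r < n - m)
     ((parts_in n pi r (r + m.+1))%:R - (parts_in n pi r (r + m))%:R) 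
  = (largest_part pi - smallest_part pi <= m < largest_part pi)%:R :> A.
Proof.
move=> lt_mn; set s := smallest_part pi; set l := largest_part pi.
have le_ln : (l <= n)%N := largest_part_leq.
have le_sl : (s <= l)%N := smallest_part_leq.
have s_gt0 : (0 < s)%N := smallest_part_gt0.
rewrite (eq_big_nat _ _ (F2 := fun r => ((r < s) && (l == r + m.+1))%N%:R)); last first.
  move=> r /andP[_ lt_r]; rewrite !parts_inE -/s -/l; try lia.
  case: (r < s)%N; rewrite ?subrr //= addnS leq_eqVlt ltnS.
  case: eqP => [->|_] /=; last by rewrite subrr.
  by rewrite ltnn subr0.
rewrite big_mkord; case: (ltnP m l) => [lt_ml|le_lm].
  have lt_i : (l - m.+1 < n - m)%N by lia.
  rewrite (bigD1 (Ordinal lt_i)) //= big1 ?addr0 => [|i]; last first.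
    rewrite -val_eqE /= => neq_i; case: eqP => [l_eq|_]; last by rewrite andbF.
    by case/eqP: neq_i; lia.
  congr (_ %:R); lia.
rewrite andbF big1 // => i _; case: eqP; rewrite ?andbF //; lia.
Qed.

Lemma sum_window (A : nzRingType) (a : nat -> A) :
  \sum_(1 <= j < (smallest_part pi).+1)
     a (largest_part pi - smallest_part pi + j)%N
  = \sum_(0 <= m < n) a m.+1
      * (largest_part pi - smallest_part pi <= m < largest_part pi)%:R.
Proof.
set s := smallest_part pi; set l := largest_part pi.
have le_ln : (l <= n)%N := largest_part_leq.
have le_sl : (s <= l)%N := smallest_part_leq.
transitivity (\sum_(l - s <= m < l) a m.+1).
  rewrite -[(l - s)%N in RHS]add0n big_addn big_add1 subKn //.
  by apply: eq_bigr => i _; rewrite addnS addnC.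
rewrite (big_nat_widenl _ 0) // (big_nat_widen _ _ n) // big_mkcond.
by apply: eq_bigr => m _; rewrite mulr_natr mulrb.
Qed.

End SmallestLargest.

(** * Partition weights, divisor coefficients and the final summation *)

Lemma partition_weight (F : fieldType) (t : F) n (pi : multiplicities n) :
  t != 0 -> (0 < n)%N -> pi \in partitions n ->
  (t - 1) * (t ^+ (num_parts pi - 1)
             * ((t - 1) / t) ^+ (num_distinct_parts pi - 1))
  = \prod_i mult_weight F t (pi i).
Proof.
move=> t0 n_gt0 pi_part.
have [i0 pi0] := part_exists n pi n_gt0 pi_part.
have k_gt0 : (0 < num_parts pi)%N by rewrite /num_parts (bigD1 i0) //= addn_gt0 pi0.
have Q_gt0 : (0 < num_distinct_parts pi)%N.
  by rewrite card_gt0; apply/set0Pn; exists i0; rewrite inE.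
(* The factor [t - 1] supplies the missing t * ((t - 1) / t); both counts are positive, so the
   natural subtractions are exact. *)
transitivity (t ^+ num_parts pi * ((t - 1) / t) ^+ num_distinct_parts pi).
  case: (num_parts pi) k_gt0 (num_distinct_parts pi) Q_gt0 => // k _ [//|q] _.
  by rewrite !subn1 /= !exprS; field.
rewrite /num_parts /num_distinct_parts expr_sum -sum1_card expr_sum.
rewrite [X in _ * X]big_mkcond -big_split; apply: eq_bigr => i _ /=.
rewrite inE; case: (nat_of_ord (pi i)) => [|k] /=; first by rewrite mulr1.
by rewrite exprS expr1; field.
Qed.

(** [window_identity] is applied to the class of X modulo X^(n+1), which preserves the coefficient
    of X^n; in the sum of the X^(dk) this coefficient detects d | n. *)
Lemma coef_window_sum (A : comNzRingType) (t : A) n m : (m < n)%N ->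
  (\sum_(0 <= r < n - m)
     (\prod_(r <= i < r + m.+1) part_gf {poly A} n t%:P ('X ^+ i.+1)
      - \prod_(r <= i < r + m) part_gf {poly A} n t%:P ('X ^+ i.+1)))`_n
  = (t - 1) * \sum_(m.+1 <= d < n.+1) t ^+ (d - m.+1) * (d %| n)%:R.
Proof.
move=> lt_mn; pose f := in_qpoly 'X^(n.+1) : {rmorphism {poly A} -> _}.
have X_nil : f 'X ^+ n.+1 = 0.
  rewrite -rmorphXn; apply/val_inj => /=.
  by rewrite mk_monic_Xn Pdiv.RingMonic.rmodpp // monicXn.
rewrite (_ : _`_n = ((t%:P - 1) * \sum_(m.+1 <= d < n.+1) t%:P ^+ (d - m.+1)
            * \sum_(1 <= k < n.+1) 'X^(d * k))`_n).
  have -> : t%:P - 1 = (t - 1)%:P by rewrite polyCB.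
  rewrite coefCM coef_sum; congr (_ * _); apply: eq_big_nat => d /andP[d_gt le_dn].
  rewrite -polyC_exp coefCM coef_sum; congr (_ * _).
  under eq_bigr do rewrite coefXn.
  have [/dvdnP[k n_eq]|ndvd] := boolP (d %| n)%N.
    rewrite (bigD1_seq k) ?iota_uniq //=; last by rewrite mem_index_iota; nia.
    rewrite {1}n_eq mulnC eqxx big1 ?addr0 // => j /negbTE neq_jk.
    by rewrite {1}n_eq mulnC eqn_pmul2l ?(leq_ltn_trans _ d_gt) // eq_sym neq_jk.
  rewrite big1 // => k _; case: eqP => // n_eq.
  by rewrite n_eq dvdn_mulr in ndvd.
apply: in_qpolyXn_coef; rewrite -!/(f _).
rewrite rmorph_sum rmorphM rmorphB rmorph1 rmorph_sum.
transitivity (\sum_(0 <= r < n - m)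
     (\prod_(r <= i < r + m.+1) part_gf _ n (f t%:P) (f 'X ^+ i.+1)
      - \prod_(r <= i < r + m) part_gf _ n (f t%:P) (f 'X ^+ i.+1))).
  apply: eq_bigr => r _; rewrite rmorphB !rmorph_prod.
  by congr (_ - _); apply: eq_bigr => i _; rewrite rmorph_part_gf rmorphXn.
rewrite window_identity //; congr (_ * _); apply: eq_bigr => d _.
rewrite rmorphM rmorphXn rmorph_sum; congr (_ * _).
by apply: eq_bigr => k _; rewrite rmorphXn.
Qed.

Theorem theorem4 (R : realType) (a : nat -> R[i]) (t : R[i]) (n : nat)
    (t_neq0 : t <> 0) (t_neq1 : t <> 1) (n_gt0 : (0 < n)%N) :
  \sum_(pi in partitions n)
     t ^+ (num_parts pi - 1) * ((t - 1) / t) ^+ (num_distinct_parts pi - 1)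
     * (\sum_(1 <= j < (smallest_part pi).+1)
          a (largest_part pi - smallest_part pi + j)%N)
  = \sum_(d <- divisors n) t ^+ d * (\sum_(1 <= m < d.+1) a m / t ^+ m).
Proof.
have t0 : t != 0 by apply/eqP.
have t1 : t - 1 != 0 by rewrite subr_eq0; apply/eqP.
apply: (mulfI t1); rewrite mulr_sumr.
(* Both sides are compared through the coefficient of each [a m.+1]. *)
transitivity (\sum_(0 <= m < n) a m.+1 * ((t - 1) *
    \sum_(m.+1 <= d < n.+1) t ^+ (d - m.+1) * (d %| n)%N%:R)).
  transitivity (\sum_(pi in partitions n) \sum_(0 <= m < n)
      a m.+1 * ((\prod_i mult_weight _ t (pi i))
        * (largest_part pi - smallest_part pi <= m < largest_part pi)%N%:R)).
    apply: eq_bigr => pi pi_part.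
    rewrite mulrA partition_weight // sum_window // mulr_sumr.
    by apply: eq_bigr => m _; rewrite mulrCA.
  rewrite exchange_big /=; apply: eq_big_nat => m /andP[_ lt_mn].
  rewrite -mulr_sumr -coef_window_sum // coef_sum; congr (_ * _).
  transitivity (\sum_(pi in partitions n) \sum_(0 <= r < n - m)
     ((\prod_i mult_weight _ t (pi i)) * (parts_in n pi r (r + m.+1))%:R
      - (\prod_i mult_weight _ t (pi i)) * (parts_in n pi r (r + m))%:R)).
    apply: eq_bigr => pi pi_part; rewrite -sum_parts_in_windows // mulr_sumr.
    by apply: eq_bigr => r _; rewrite mulrBr.
  rewrite exchange_big /=; apply: eq_big_nat => r /andP[_ lt_r].
  by rewrite sumrB coefB !coef_window_prod //; lia.
under eq_bigr do rewrite mulrCA.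
rewrite -mulr_sumr; congr (_ * _).
(* Exchange of summation over the triangle 1 <= m <= d <= n. *)
transitivity (\sum_(1 <= d < n.+1) \sum_(1 <= m < d.+1)
    a m * (t ^+ (d - m) * (d %| n)%N%:R)).
  transitivity (\sum_(1 <= m < n.+1) \sum_(m <= d < n.+1)
      a m * (t ^+ (d - m) * (d %| n)%N%:R)).
    by rewrite [RHS]big_add1; apply: eq_bigr => m _; rewrite mulr_sumr.
  rewrite (eq_big_nat _ _ (F2 := fun m => \sum_(1 <= d < n.+1 | (m <= d)%N)
      a m * (t ^+ (d - m) * (d %| n)%N%:R))); last first.
    by move=> m /andP[m_gt0 _]; rewrite (big_nat_widenl _ 1).
  rewrite (exchange_big_dep_nat predT) //=; apply: eq_big_nat => d /andP[_ le_dn].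
  by rewrite [RHS](big_nat_widen _ _ n.+1).
rewrite [RHS](perm_big [seq d <- index_iota 1 n.+1 | d %| n]%N) /=; last first.
  apply: uniq_perm; rewrite ?divisors_uniq ?filter_uniq ?iota_uniq // => d.
  rewrite mem_filter mem_index_iota. rewrite -dvdn_divisors //.
  case: (boolP (d %| n)%N) => //= d_n.
  by rewrite (dvdn_gt0 n_gt0) // ltnS dvdn_leq.
rewrite [RHS]big_filter [RHS]big_mkcond; apply: eq_bigr => d _.
case: (d %| n)%N; last by rewrite big1 // => m _; rewrite !mulr0.
rewrite mulr_sumr; apply: eq_big_nat => m /andP[_ le_md].
by rewrite mulr1 expfB_cond ?(negbTE t0) // mulrCA mulrA.
Qed.
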